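(* Let $\mathbb{K}$ be an algebraically closed field of characteristic zero and $N=2m\ge 2$ even. Then $\operatorname{Aut}(\mathcal{H}_{N}')\cong \mathbf{GSp}_{N}(\mathbb{Z})\ltimes (\mathbb{K}^{\times})^{N}$.
   Context: Let $A_N=\mathbb{K}[t_1^{\pm1},\dots,t_N^{\pm1}]$, $d_i=t_i\frac{\partial}{\partial t_i}$, and $t^{\bm r}=t_1^{r_1}\cdots t_N^{r_N}$ for $\bm r\in\mathbb{Z}^N$. Let $(\cdot,\cdot)$ be the standard bilinear form on $\mathbb{K}^N$, $(e_i,e_j)=\delta_{ij}$. For $u\in\mathbb{K}^N$, $\bm r\in\mathbb{Z}^N$ put $D(u,\bm r)=\sum_i u_i t^{\bm r}d_i$. Let $\bm J=\begin{pmatrix} O_m & I_m\\ -I_m & O_m\end{pmatrix}$, $\overline{\bm r}=\bm J\bm r$, $h_{\bm r}=D(\overline{\bm r},\bm r)$. The Lie algebra $\mathcal{H}_N'=\operatorname{span}_{\mathbb{K}}\{h_{\bm r}:\bm r\in\mathbb{Z}^N\setminus\{\bm 0\}\}$ (the derived subalgebra of the Hamiltonian Lie algebra) has bracket $[h_{\bm r},h_{\bm s}]=(\overline{\bm r},\bm s)h_{\bm r+\bm s}$ (with $h_{\bm 0}=0$). $\mathbf{GSp}_N(\mathbb{Z})=\{\bm Q\in\mathbf{GL}_N(\mathbb{Z}):\bm Q^\top\bm J\bm Q=\pm\bm J\}$. The symbol $\ltimes$ denotes a semidirect product with $(\mathbb{K}^\times)^N$ the normal subgroup. *)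

(* Defs.v *)
From HB Require Import structures.
From mathcomp Require Import all_boot all_order all_algebra.
Set Implicit Arguments. Unset Strict Implicit. Unset Printing Implicit Defensive.
Import Order.TTheory GRing.Theory Num.Theory.
Local Open Scope ring_scope.

Definition Jmat (m : nat) : 'M[int]_(m + m) :=
  block_mx 0 1%:M (- 1%:M) 0.

Definition omega (m : nat) (r s : 'cV[int]_(m + m)) : int :=
  \sum_i (Jmat m *m r) i 0 * s i 0.

Definition is_GSp (m : nat) (Q : 'M[int]_(m + m)) : Prop :=
  Q \in unitmx /\ (Q^T *m Jmat m *m Q = Jmat m \/ Q^T *m Jmat m *m Q = - Jmat m).

Definition is_torus (K : fieldType) (n : nat) (a : 'rV[K]_n) : Prop :=
  forall i, a 0 i != 0.

(* right action of integer matrices on the torus: (a^Q)_i = prod_j a_j^(Q_ji),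
   i.e. the character a^Q evaluated at s equals the character a evaluated at Q s *)
Definition torus_act (K : fieldType) (n : nat) (Q : 'M[int]_n) (a : 'rV[K]_n)
  : 'rV[K]_n := \row_i \prod_j (a 0 j) ^ (Q j i).

(* group law of GSp_N(Z) |x (K^x)^N on pairs (Q, a) (torus normal):
   (Q1, a1) (Q2, a2) = (Q1 Q2, a1^Q2 * a2) *)
Definition sd_mulM (n : nat) (Q1 Q2 : 'M[int]_n) : 'M[int]_n := Q1 *m Q2.
Definition sd_mulT (K : fieldType) (n : nat) (Q2 : 'M[int]_n) (a1 a2 : 'rV[K]_n)
  : 'rV[K]_n := \row_i (torus_act Q2 a1 0 i * a2 0 i).

Definition is_Hprime (K : fieldType) (m : nat) (L : lmodType K)
  (br : L -> L -> L) (h : 'cV[int]_(m + m) -> L) : Prop :=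
  (forall (c : K) x y z, br (c *: x + y) z = c *: br x z + br y z) /\
  (forall (c : K) x y z, br z (c *: x + y) = c *: br z x + br z y) /\
  [/\ h 0 = 0,
      (forall (s : seq 'cV[int]_(m + m)) (c : 'cV[int]_(m + m) -> K),
          uniq s -> all (fun r => r != 0) s ->
          \sum_(r <- s) c r *: h r = 0 -> forall r, r \in s -> c r = 0),
      (forall x : L, exists (s : seq 'cV[int]_(m + m)) (c : 'cV[int]_(m + m) -> K),
          x = \sum_(r <- s) c r *: h r) &
      (forall r s, br (h r) (h s) = (omega r s)%:~R *: h (r + s))].

Definition is_LieAut (K : fieldType) (L : lmodType K) (br : L -> L -> L)
  (f : L -> L) : Prop :=
  [/\ (forall (c : K) x y, f (c *: x + y) = c *: f x + f y),
      bijective f &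
      (forall x y, f (br x y) = br (f x) (f y))].

(* Main.v *)
Require Import Defs.
From HB Require Import structures.
From mathcomp Require Import all_boot all_order all_algebra.
From mathcomp Require Import zify ring.
Import Order.TTheory GRing.Theory Num.Theory.
Local Open Scope ring_scope.
Set Implicit Arguments.
Unset Strict Implicit.
Unset Printing Implicit Defensive.

(** Let [d_i h_r = r_i h_r] be the degree derivations. If [f] is an automorphism,
    [E = f^-1 d_i f] is a locally finite derivation. Every derivation is a degree
    zero derivation plus some [ad x]: each homogeneous component of degree
    [p <> 0] is a multiple of [ad h_p]. If [x <> 0], let [p] be a point of maximal
    Euclidean norm in its support; the iterates [E^k h_s] then have leading term a
    nonzero multiple of [h_(s + k p)] as soon as [omega p s <> 0], which
    contradicts local finiteness. So [E] is diagonal, [f h_r] is a common weight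
    vector of all [d_i], and hence [f h_r = b(r) h_(sigma r)]. Comparing brackets,
    [sigma] is additive and preserves the zeros of [omega], so it preserves [omega]
    up to a factor, which is a unit of Z by surjectivity; up to this sign [b] is
    a character. *)

(** * The integral symplectic form *)

Section SymplecticForm.
Variable m : nat.
Implicit Types (r s t u v : 'cV[int]_(m + m)) (Q : 'M[int]_(m + m)).

Lemma mul_Jmat_rshift r i : (Jmat m *m r) (rshift m i) 0 = - r (lshift m i) 0.
Proof.
rewrite -{1}[r]vsubmxK /Jmat mul_block_col col_mxEd mul0mx mulNmx mul1mx addr0.
by rewrite !mxE.
Qed.

Lemma omegaE r s : omega r s = (r^T *m (Jmat m)^T *m s) 0 0.
Proof.
by rewrite -trmx_mul /omega mxE; apply: eq_bigr => i _; rewrite [in RHS]mxE.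
Qed.

Lemma omegaDl r s t : omega (r + s) t = omega r t + omega s t.
Proof. by rewrite !omegaE raddfD /= !mulmxDl mxE. Qed.

Lemma omegaDr r s t : omega t (r + s) = omega t r + omega t s.
Proof. by rewrite !omegaE mulmxDr mxE. Qed.

Lemma omegaZl z r s : omega (z *: r) s = z * omega r s.
Proof. by rewrite !omegaE linearZ /= -!scalemxAl mxE. Qed.

Lemma omegaZr z r s : omega r (z *: s) = z * omega r s.
Proof. by rewrite !omegaE -scalemxAr mxE. Qed.

Lemma omegaNl r s : omega (- r) s = - omega r s.
Proof. by rewrite -scaleN1r omegaZl mulN1r. Qed.

Lemma omegaNr r s : omega r (- s) = - omega r s.
Proof. by rewrite -scaleN1r omegaZr mulN1r. Qed.

Lemma omega0l s : omega 0 s = 0.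
Proof. by rewrite -(scale0r 0) omegaZl mul0r. Qed.

Lemma omega0r s : omega s 0 = 0.
Proof. by rewrite -(scale0r 0) omegaZr mul0r. Qed.

Lemma trmx_Jmat : (Jmat m)^T = - Jmat m.
Proof.
by rewrite /Jmat tr_block_mx !trmx0 linearN /= !trmx1 opp_block_mx !oppr0 opprK.
Qed.

Lemma omega_antisym r s : omega r s = - omega s r.
Proof.
have -> : omega r s = (r^T *m (Jmat m)^T *m s)^T 0 0 by rewrite mxE omegaE.
rewrite omegaE trmx_mul trmx_mul !trmxK.
by rewrite trmx_Jmat mulmxN mulNmx [X in _ = - X]mxE opprK mulmxA.
Qed.

Lemma omegarr r : omega r r = 0.
Proof. by have := omega_antisym r r; lia. Qed.

Lemma mul_JmatJmat : Jmat m *m Jmat m = - 1%:M.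
Proof.
rewrite /Jmat mulmx_block !mul0mx !mulmx0 !mul1mx mulmx1 !addr0 !add0r.
by rewrite [in RHS]scalar_mx_block opp_block_mx !oppr0.
Qed.

Lemma omega_delta r i : omega r (delta_mx i 0) = (Jmat m *m r) i 0.
Proof.
rewrite /omega (bigD1 i) //= big1 ?addr0; first by rewrite !mxE !eqxx mulr1.
by move=> j /negPf ji; rewrite [X in _ * X]mxE ji mulr0.
Qed.

Lemma omega_delta_neq0 r : r != 0 -> exists i, omega r (delta_mx i 0) != 0.
Proof.
move=> r0; have /matrix0Pn [i [j]] : Jmat m *m r != 0.
  apply: contra_neq r0 => Jr0.
  rewrite -[r]opprK -[- r]mul1mx mulmxN -mulNmx -mul_JmatJmat -mulmxA Jr0.
  by rewrite mulmx0 oppr0.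
by rewrite ord1 -omega_delta => nz; exists i.
Qed.

Lemma omega_delta_pair (i : 'I_m) :
  omega (delta_mx (rshift m i) 0) (delta_mx (lshift m i) 0) = 1.
Proof.
rewrite omega_antisym omega_delta mul_Jmat_rshift.
by rewrite mxE !eqxx opprK.
Qed.

(** If the [t] found for the tail is orthogonal to the new [v], pass to [u + M t] with [omega v u]
    nonzero: [v] only sees [u], while on the tail the nonzero integer [omega x t], scaled by [M],
    outweighs [omega x u]. *)
Lemma omega_common_nonorthogonal (l : seq 'cV[int]_(m + m)) :
  all (fun v => v != 0) l -> exists t, all (fun v => omega v t != 0) l.
Proof.
elim: l => [|v l IH] /=; first by exists 0.
case/andP=> /omega_delta_neq0 [i]; set u := delta_mx i 0 => vu /IH [t lt].
have [vt|vt] := eqVneq (omega v t) 0; last by exists t; rewrite vt.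
pose M := (1 + \sum_(x <- l) `|omega x u|)%N.
exists (u + M%:Z *: t).
rewrite omegaDr omegaZr vt mulr0 addr0 vu /=.
apply/allP => x xl; rewrite omegaDr omegaZr.
have: (`|omega x u| < M)%N.
  by rewrite /M (big_rem x xl) /=; lia.
have := allP lt x xl; move: (omega x t) (omega x u) => a b a0 bM.
nia.
Qed.

(* For orthogonal r and s, split r + (s + t) in two ways for a generic t. *)
Lemma morph_of_nonorthogonal (T : Type) (op : T -> T -> T) (e : T)
    (phi : 'cV[int]_(m + m) -> T) :
  associative op -> commutative op -> left_id e op ->
  (forall x y t, op x (phi t) = op y (phi t) -> x = y) -> phi 0 = e ->
  (forall r s, omega r s != 0 -> phi (r + s) = op (phi r) (phi s)) ->
  forall r s, phi (r + s) = op (phi r) (phi s).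
Proof.
move=> opA opC op1 opI phi0 phiD r s.
have [rs|] := eqVneq (omega r s) 0; last exact: phiD.
have [->|r0] := eqVneq r 0; first by rewrite add0r phi0 op1.
have [->|s0] := eqVneq s 0; first by rewrite addr0 phi0 opC op1.
(* Nothing is nonorthogonal to 0, so [r + s] is left out of the list when it vanishes; that case is
   settled by [phi 0 = e]. *)
have [|t] := @omega_common_nonorthogonal
  (r :: s :: if r + s == 0 then [::] else [:: r + s]).
  by rewrite /= r0 s0; case: ifP => //= ->.
case/and3P => rt st rst.
have opr : phi (r + (s + t)) = op (phi r) (op (phi s) (phi t)).
  by rewrite !phiD // omegaDr rs add0r.
apply: (opI _ _ t); rewrite -opA -opr addrA.
move: rst; have [rs0 _|_ /andP [rst _]] := eqVneq (r + s) 0; last exact/esym/phiD.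
by rewrite rs0 phi0 op1 add0r.
Qed.

End SymplecticForm.

(** * Homogeneous derivations in characteristic zero *)

Lemma intr_eq0_pchar0 (K : fieldType) (hK : [pchar K] =i pred0) (z : int) :
  (z%:~R == 0 :> K) = (z == 0).
Proof.
have natr0 := (pcharf0P K).1 hK.
by case: z => n; rewrite ?NegzE ?rmorphN ?oppr_eq0 /= -pmulrn natr0.
Qed.

Section HomogeneousDerivation.
Variables (K : fieldType) (m : nat).
Hypothesis hK : [pchar K] =i pred0.
Implicit Types (r s t u v p : 'cV[int]_(m + m)).
Local Notation w r s := ((omega r s)%:~R : K).

(* The equation satisfied by the coefficients of a derivation
   h_r |-> c(r) h_(r+p) of degree p; its solutions are those of ad h_p. *)
Lemma homogeneous_derivation_inner p (c : 'cV[int]_(m + m) -> K) :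
  p != 0 -> c 0 = 0 -> c (- p) = 0 ->
  (forall r s, w r s * c (r + s) = w (r + p) s * c r + w r (s + p) * c s) ->
  exists k, forall r, c r = k * w p r.
Proof.
move=> p0 c0 cNp ceq.
have w0 r s : (w r s == 0) = (omega r s == 0) by exact: intr_eq0_pchar0.
have wDl r s t : w (r + s) t = w r t + w s t by rewrite omegaDl rmorphD.
have wDr r s t : w t (r + s) = w t r + w t s by rewrite omegaDr rmorphD.
have wC r s : w r s = - w s r by rewrite omega_antisym rmorphN.
have wrr r : w r r = 0 by rewrite omegarr.
have wN r s : w r (- s) = - w r s by rewrite omegaNr rmorphN.
(* The relation at [(r, - p)], with [c (- p) = 0], makes [c] invariant under translation by [p] off
   the hyperplane orthogonal to [p]. *)
have cB r : w r p != 0 -> c (r - p) = c r.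
  move=> rp; apply: (mulfI rp).
  have := ceq r (- p); rewrite cNp mulr0 addr0 wDl !wN wrr oppr0 addr0.
  by rewrite !mulNr => /oppr_inj.
have cD r : w r p != 0 -> c (r + p) = c r.
  by move=> rp; rewrite -(cB (r + p)) ?addrK // wDl wrr addr0.
(* Subtract the relation at [(r, s)] from the one at [(r, s + p)]: by invariance, every remaining
   term carries the factor [w r p]. *)
have cadd r s : w r p != 0 -> w s p != 0 -> w (r + s) p != 0 ->
    c (r + s) = c r + c s.
  move=> rp sp rsp; apply: (mulfI rp).
  have := ceq r (s + p); rewrite addrA !cD // => E; have E' := ceq r s.
  rewrite !wDl !wDr !wrr (wC p s) in E E' *.
  transitivity (w r p * c (r + s) + (w r s * c (r + s) - w r s * c (r + s)));
    first by ring.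
  by rewrite {2}E' addrA -mulrDl [w r p + _]addrC E; ring.
(* Additivity, put back into the relation at [(r, s)], cancels the terms in [w r s]. *)
have prop3 r s : w r p != 0 -> w s p != 0 -> w (r + s) p != 0 ->
    w p s * c r = w p r * c s.
  move=> rp sp rsp; have := ceq r s; rewrite cadd // wDl wDr (wC r p) => E.
  apply/eqP; rewrite -subr_eq0; apply/eqP.
  transitivity ((w r s + w p s) * c r + (w r s - w p r) * c s
                - w r s * (c r + c s)); first by ring.
  by rewrite E; ring.
have n2 : 2%:R != 0 :> K by rewrite ((pcharf0P K).1 hK).
(* When [r + s] is orthogonal to [p], apply the previous step to [r + r] and [s], then divide by
   2. *)
have prop r s : w r p != 0 -> w s p != 0 -> w p s * c r = w p r * c s.
  move=> rp sp; have [rsp|] := eqVneq (w (r + s) p) 0; last exact: prop3.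
  have r2 : w (r + r) p != 0 by rewrite wDl -mulr2n -mulr_natl mulf_neq0.
  apply: (mulfI n2); have := prop3 (r + r) s r2 sp.
  rewrite -addrA wDl rsp addr0 => /(_ rp); rewrite cadd // wDr => E.
  by rewrite mulrCA mulr_natl mulr2n E; ring.
have [i] := omega_delta_neq0 p0; set u := delta_mx i 0 => pu.
have up : w u p != 0 by rewrite w0 omega_antisym oppr_eq0.
have cE r : w r p != 0 -> c r = c u / w p u * w p r.
  move=> rp; have pu' : w p u != 0 by rewrite w0.
  by apply: (mulfI pu'); rewrite (prop r u) // mulrCA [RHS]mulrA divfK // mulrC.
exists (c u / w p u) => r; have [rp|] := eqVneq (w r p) 0; last exact: cE.
have [->|r0] := eqVneq r 0; first by rewrite c0 omega0r mulr0.
(* For [r] orthogonal to [p] the claim is [c r = 0]. Split [r = v + (r - v)] with both summands off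
   the hyperplane, where [c] is known: the right side of the relation cancels, and [w v r] is
   nonzero. *)
have [|v /and3P [pv rv _]] := @omega_common_nonorthogonal m [:: p; r].
  by rewrite /= p0 r0.
have vp : w v p != 0 by rewrite w0 omega_antisym oppr_eq0.
have vr : w v r != 0 by rewrite w0 omega_antisym oppr_eq0.
have wNl a b : w (- a) b = - w a b by rewrite omegaNl rmorphN.
have rvp : w (r - v) p != 0 by rewrite wDl rp add0r wNl oppr_eq0.
have := ceq v (r - v); rewrite [v + (r - v)]addrC subrK (cE v) // (cE (r - v)) // => E.
have E2 : w v (r - v) = w v r by rewrite wDr wN wrr subr0.
apply: (mulfI vr); rewrite (wC p r) rp oppr0 !mulr0 -E2 E.
rewrite !wDl !wDr !wN !wrr (wC p r) rp (wC v p); ring.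
Qed.

End HomogeneousDerivation.

(** * Linear maps given as plain functions *)

Section LinearMaps.
Variable K : comPzRingType.
Implicit Types (U V W : lmodType K).

Lemma linear_map0 U V (f : U -> V) : linear f -> f 0 = 0.
Proof. by move=> fL; have := fL (-1) 0 0; rewrite scaler0 addr0 scaleN1r addNr. Qed.

Lemma linear_mapZ U V (f : U -> V) c (x : U) : linear f -> f (c *: x) = c *: f x.
Proof. by move=> fL; have := fL c x 0; rewrite !addr0 (linear_map0 fL) addr0. Qed.

Lemma linear_mapD U V (f : U -> V) (x y : U) : linear f -> f (x + y) = f x + f y.
Proof. by move=> fL; have := fL 1 x y; rewrite !scale1r. Qed.

Lemma linear_map_sum U V (f : U -> V) I (s : seq I) (c : I -> K) (F : I -> U) :
  linear f -> f (\sum_(i <- s) c i *: F i) = \sum_(i <- s) c i *: f (F i).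
Proof.
move=> fL; elim: s => [|i s IH]; first by rewrite !big_nil linear_map0.
by rewrite !big_cons fL IH.
Qed.

Lemma linear_comp U V W (f : V -> W) (g : U -> V) :
  linear f -> linear g -> linear (f \o g).
Proof. by move=> fL gL c x y; rewrite /= gL fL. Qed.

Lemma linear_add U V (f g : U -> V) :
  linear f -> linear g -> linear (fun x => f x + g x).
Proof. by move=> fL gL c x y; rewrite /= gL fL scalerDr addrACA. Qed.

Lemma linear_scale U V (f : U -> V) c : linear f -> linear (fun x => c *: f x).
Proof. by move=> fL d x y; rewrite fL scalerDr !scalerA mulrC. Qed.

End LinearMaps.

(** * Coordinates and linear extension in the basis of nonzero exponents *)

Section LinearExtension.
Variables (K : fieldType) (m : nat) (L : lmodType K) (br : L -> L -> L).
Variable h : 'cV[int]_(m + m) -> L.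
Hypothesis hL : @is_Hprime K m L br h.
Implicit Types (r s t p q : 'cV[int]_(m + m)) (x y : L).
Implicit Types (V : lmodType K) (l : seq ('cV[int]_(m + m) * K)).

Lemma h0 : h 0 = 0. Proof. by case: hL => _ [_ []]. Qed.

Lemma br_h r s : br (h r) (h s) = (omega r s)%:~R *: h (r + s).
Proof. by case: hL => _ [_ []]. Qed.

Lemma br_linearl y : linear (br^~ y).
Proof. by case: hL => brl _ c x z; apply: brl. Qed.

Lemma br_linearr x : linear (br x).
Proof. by case: hL => _ [brr _] c z y; apply: brr. Qed.

(** Repeated indices and the index 0 are allowed, so that adding combinations is concatenating
    lists. *)
Definition combination V (F : 'cV[int]_(m + m) -> V) l : V :=
  \sum_(q <- l) q.2 *: F q.1.

(** Produces distinct nonzero indices, the form to which the freeness clause of [is_Hprime]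
    applies. *)
Lemma combination_regroup V (F : 'cV[int]_(m + m) -> V) l : F 0 = 0 ->
  combination F l = \sum_(r <- [seq r <- undup (unzip1 l) | r != 0])
    (\sum_(q <- l | q.1 == r) q.2) *: F r.
Proof.
move=> F0; rewrite big_filter.
transitivity (\sum_(q <- l) \sum_(r <- undup (unzip1 l) | r != 0)
   (if q.1 == r then q.2 *: F r else 0)).
  rewrite /combination big_seq [RHS]big_seq; apply: eq_bigr => q ql.
  rewrite -big_mkcondr /=.
  have [q0|q0] := eqVneq q.1 0.
    rewrite q0 F0 scaler0 big1 // => r /andP [/negPf r0 /eqP r0'].
    by rewrite -r0' eqxx in r0.
  rewrite -big_filter (_ : [seq i <- _ | _] = [:: q.1]) ?big_seq1 //.
  rewrite (@eq_filter _ _ (pred1 q.1)) ?filter_pred1_uniq ?undup_uniq ?mem_undup ?map_f //.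
  by move=> r /=; case: (eqVneq r q.1) => [->|_]; rewrite ?q0 ?andbF.
rewrite exchange_big /=; apply: eq_bigr => r r0.
by rewrite scaler_suml [in RHS]big_mkcond /=.
Qed.

(** This makes [extend] independent of the chosen expansion: after regrouping, freeness kills every
    coefficient. *)
Lemma combination_eq0 V (F : 'cV[int]_(m + m) -> V) l : F 0 = 0 ->
  combination h l = 0 -> combination F l = 0.
Proof.
move=> F0; rewrite !combination_regroup ?h0 // => E.
have [_ [_ [_ hfree _ _]]] := hL.
rewrite big_seq big1 // => r rl.
rewrite (hfree _ _ _ _ E r rl) ?scale0r ?filter_uniq ?undup_uniq //.
by apply/allP => q; rewrite mem_filter => /andP [].
Qed.

(** Stated with boolean equality so that [xchoose] can pick an expansion. *)
Lemma combination_surj x : exists l, x == combination h l.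
Proof.
have [_ [_ [_ _ /(_ x) [s [c ->]] _]]] := hL.
by exists [seq (r, c r) | r <- s]; rewrite /combination big_map.
Qed.

Definition expansion x := xchoose (combination_surj x).

Lemma expansionK x : combination h (expansion x) = x.
Proof. by rewrite -(eqP (xchooseP (combination_surj x))). Qed.

Definition extend V (F : 'cV[int]_(m + m) -> V) x : V := combination F (expansion x).

Lemma combinationD V (F : 'cV[int]_(m + m) -> V) c l1 l2 :
  combination F ([seq (z.1, c * z.2) | z <- l1] ++ l2)
  = c *: combination F l1 + combination F l2.
Proof.
rewrite /combination big_cat big_map scaler_sumr /=; congr (_ + _).
by apply: eq_bigr => q _; rewrite scalerA.
Qed.

Lemma extend_combination V (F : 'cV[int]_(m + m) -> V) l : F 0 = 0 ->
  extend F (combination h l) = combination F l.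
Proof.
move=> F0; apply/eqP; rewrite eq_sym -subr_eq0 addrC -scaleN1r -combinationD.
apply/eqP/combination_eq0 => //.
by rewrite combinationD expansionK scaleN1r addNr.
Qed.

Lemma extend_linear V (F : 'cV[int]_(m + m) -> V) : F 0 = 0 -> linear (extend F).
Proof.
move=> F0 c x y; rewrite -{1}[x]expansionK -{1}[y]expansionK -combinationD.
by rewrite extend_combination // combinationD.
Qed.

Lemma extend_h V (F : 'cV[int]_(m + m) -> V) r : F 0 = 0 -> extend F (h r) = F r.
Proof.
move=> F0; have := extend_combination [:: (r, 1)] F0.
by rewrite /combination !big_seq1 /= !scale1r.
Qed.

Lemma eq_linear V (f g : L -> V) : linear f -> linear g ->
  (forall r, f (h r) = g (h r)) -> forall x, f x = g x.
Proof.
move=> fL gL fg x; rewrite -[x]expansionK !linear_map_sum //.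
by apply: eq_bigr => q _; rewrite fg.
Qed.

Lemma eq_bilinear V (f g : L -> L -> V) :
  (forall y, linear (f^~ y)) -> (forall x, linear (f x)) ->
  (forall y, linear (g^~ y)) -> (forall x, linear (g x)) ->
  (forall r s, f (h r) (h s) = g (h r) (h s)) -> forall x y, f x y = g x y.
Proof.
move=> fl fr gl gr fg x y; apply: (@eq_linear _ (f x) (g x)) => // s.
exact: (@eq_linear _ (f^~ (h s)) (g^~ (h s))).
Qed.

(** The test [r != 0] makes the extended function vanish at 0, as [h 0 = 0] demands; the coefficient
    at exponent 0 is thus 0 by convention. *)
Definition coef x r : K :=
  extend (V := K^o) (fun q => ((q == r) && (r != 0))%:R) x.

Lemma coef_linear r : linear (coef^~ r : L -> K^o).
Proof. by apply: extend_linear; case: eqVneq => // <-; rewrite eqxx. Qed.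

Lemma coef_h q r : coef (h q) r = ((q == r) && (r != 0))%:R.
Proof. by rewrite /coef extend_h //; case: eqVneq => // <-; rewrite eqxx. Qed.

Lemma coef0 x : coef x 0 = 0.
Proof.
rewrite /coef /extend /combination big1 // => q _.
by rewrite eqxx andbF; apply: scaler0.
Qed.

Lemma coefE x r : r != 0 -> coef x r = \sum_(q <- expansion x | q.1 == r) q.2.
Proof.
move=> r0; rewrite /coef /extend /combination [RHS]big_mkcond; apply: eq_bigr => q _.
by rewrite r0 andbT; case: eqP => _; [apply: mulr1 | apply: mulr0].
Qed.

Definition supp x := [seq r <- undup (unzip1 (expansion x)) | coef x r != 0].

Lemma mem_supp x r : (r \in supp x) = (coef x r != 0).
Proof.
rewrite mem_filter mem_undup andb_idr //; apply: contraNT => rx.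
have [->|r0] := eqVneq r 0; first by rewrite coef0.
rewrite coefE // big_seq_cond big1 // => q /andP [qx /eqP qr].
by rewrite -qr map_f in rx.
Qed.

Lemma supp_uniq x : uniq (supp x).
Proof. by rewrite filter_uniq ?undup_uniq. Qed.

Lemma supp_expand x : x = \sum_(r <- supp x) coef x r *: h r.
Proof.
rewrite -{1}[x]expansionK combination_regroup ?h0 // !big_filter.
rewrite [RHS]big_mkcond [LHS]big_mkcond; apply: eq_bigr => r _ /=.
have [->|r0] := eqVneq r 0; first by rewrite coef0 eqxx.
by rewrite -coefE //; case: eqVneq => //= ->; rewrite scale0r.
Qed.

Lemma eq_coef x y : (forall r, coef x r = coef y r) -> x = y.
Proof.
move=> xy; rewrite [x]supp_expand [y]supp_expand.
rewrite (perm_big (supp y)) /=; first by apply: eq_bigr => r _; rewrite xy.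
by apply: uniq_perm; rewrite ?supp_uniq // => r; rewrite !mem_supp xy.
Qed.

Lemma h_neq0 r : r != 0 -> h r != 0.
Proof.
move=> r0; apply/eqP => hr0; have := coef_h r r.
rewrite hr0 eqxx r0 (linear_map0 (coef_linear r)) => /esym/eqP.
by rewrite oner_eq0.
Qed.

Lemma h_inj r s (c d : K) : r != 0 -> c != 0 -> c *: h r = d *: h s -> r = s.
Proof.
move=> r0 c0 /(congr1 (coef^~ r)).
rewrite !(linear_mapZ _ _ (coef_linear r)) !coef_h eqxx r0 andbT.
case: (eqVneq s r) => // _ E; move: c0; suff -> : c = 0 by rewrite eqxx.
by have := E; rewrite /GRing.scale /= mulr1 mulr0.
Qed.

Lemma coef_image (f : L -> L) y t : linear f ->
  coef (f y) t = \sum_(q <- supp y) coef y q * coef (f (h q)) t.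
Proof.
move=> fL; rewrite {1}[y]supp_expand.
exact: (linear_map_sum (V := K^o) (supp y) (coef y) h
  (linear_comp (W := K^o) (coef_linear t) fL)).
Qed.

Lemma coef_brl y s t : coef (br y (h s)) t = (omega (t - s) s)%:~R * coef y (t - s).
Proof.
move: y; apply: (@eq_linear K^o).
- exact: (linear_comp (coef_linear t) (br_linearl (h s))).
- exact: (linear_scale (V := K^o) (omega _ _)%:~R (coef_linear (t - s))).
move=> q; rewrite br_h (linear_mapZ _ _ (coef_linear t)) !coef_h.
rewrite /GRing.scale /= [q == _ - _]eq_sym subr_eq.
case: (eqVneq t (q + s)) => [->|]; last by rewrite !mulr0.
rewrite addrK.
(* When [q] or [q + s] is 0, the convention at exponent 0 may make the two coefficients differ, but
   then [omega q s] vanishes. *)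
have [->|q0] := eqVneq q 0; first by rewrite omega0l !mul0r.
case: eqVneq => // qs0.
rewrite -[q](addrK s) qs0 add0r.
by rewrite omegaNl omegarr oppr0 !mul0r.
Qed.

Lemma coef_brr y r t : coef (br (h r) y) t = (omega r (t - r))%:~R * coef y (t - r).
Proof.
move: y; apply: (@eq_linear K^o).
- exact: (linear_comp (coef_linear t) (br_linearr (h r))).
- exact: (linear_scale (V := K^o) (omega _ _)%:~R (coef_linear (t - r))).
move=> q; rewrite br_h (linear_mapZ _ _ (coef_linear t)) !coef_h.
rewrite /GRing.scale /= [q == _ - _]eq_sym subr_eq [r + q]addrC.
case: (eqVneq t (q + r)) => [->|]; last by rewrite !mulr0.
rewrite addrK.
have [->|q0] := eqVneq q 0; first by rewrite omega0r !mul0r.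
case: eqVneq => // qr0.
rewrite -[q](addrK r) qr0 add0r.
by rewrite omegaNr omegarr oppr0 !mul0r.
Qed.

End LinearExtension.

(** * Exponents of maximal Euclidean norm *)

Lemma exists_maximizer (T : eqType) (f : T -> nat) (l : seq T) a : a \in l ->
  exists2 b, b \in l & forall c, c \in l -> (f c <= f b)%N.
Proof.
elim: l a => // x [|y l] IH a _.
  by exists x; rewrite ?mem_head // => c; rewrite inE => /eqP ->.
have [b bl bmax] := IH y (mem_head _ _).
have [xb|bx] := leqP (f x) (f b).
  by exists b => [|c]; rewrite inE ?bl ?orbT // => /predU1P [->//|/bmax].
exists x => [|c]; first exact: mem_head.
by rewrite inE => /predU1P [->//|/bmax /leq_trans]; apply; apply: ltnW.
Qed.

Section Dot.
Variable n : nat.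
Implicit Types (p q r : 'cV[int]_n).

Definition dot p q : int := \sum_i p i 0 * q i 0.

Lemma dotDr p q r : dot p (q + r) = dot p q + dot p r.
Proof. by rewrite -big_split; apply: eq_bigr => i _; rewrite mxE mulrDr. Qed.

Lemma dotNr p q : dot p (- q) = - dot p q.
Proof. by rewrite -sumrN; apply: eq_bigr => i _; rewrite mxE mulrN. Qed.

Lemma dotC p q : dot p q = dot q p.
Proof. by apply: eq_bigr => i _; rewrite mulrC. Qed.

Lemma dot_ge0 p : 0 <= dot p p.
Proof. by apply: sumr_ge0 => i _; rewrite -expr2 sqr_ge0. Qed.

Lemma dot_eq0 p : (dot p p == 0) = (p == 0).
Proof.
rewrite psumr_eq0 => [|i _]; last by rewrite -expr2 sqr_ge0.
apply/allP/eqP => [p0|-> i _]; last by rewrite mxE mulr0.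
apply/matrixP => i j; rewrite ord1 mxE.
by have := p0 i (mem_index_enum i); rewrite mulf_eq0 orbb => /eqP.
Qed.

(** The positive number [dot (q - p) (q - p)] is at most [2 (dot p p - dot p q)]. *)
Lemma dot_lt_max p q : dot q q <= dot p p -> q != p -> dot p q < dot p p.
Proof.
rewrite -subr_eq0 -dot_eq0 => qp; have := dot_ge0 (q - p).
rewrite dotDr dotNr ![dot (q - p) _]dotC !dotDr !dotNr [dot q p]dotC.
by move: qp; move: (dot p q) (dot q q) (dot p p) => a b c; lia.
Qed.

End Dot.

(** * Locally finite derivations are diagonal *)

Section Derivations.
Variables (K : fieldType) (m : nat) (L : lmodType K) (br : L -> L -> L).
Variable h : 'cV[int]_(m + m) -> L.
Hypothesis hL : @is_Hprime K m L br h.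
Hypothesis hK : [pchar K] =i pred0.
Implicit Types (r s t p q : 'cV[int]_(m + m)) (x y : L).
Local Notation coef := (coef hL).
Local Notation supp := (supp hL).

Definition is_derivation (E : L -> L) :=
  linear E /\ forall x y, E (br x y) = br (E x) y + br x (E y).

(** Amounts to the iterates of each [y] spanning a finite-dimensional space. *)
Definition locally_finite (E : L -> L) := forall y,
  exists S : seq 'cV[int]_(m + m), forall k t, coef (iter k E y) t != 0 -> t \in S.

Definition component (E : L -> L) p r := coef (E (h r)) (r + p).

(** Read the Leibniz rule for [h r] and [h s] at exponent [r + s + p]. The component vanishes at
    [- p] because coefficients at exponent 0 do. *)
Lemma component_inner E p : is_derivation E -> p != 0 ->
  exists k, forall r, component E p r = k * (omega p r)%:~R.
Proof.
move=> [EL ED] p0; apply: (homogeneous_derivation_inner hK p0).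
- by rewrite /component (h0 hL) (linear_map0 EL) (linear_map0 (coef_linear hL _)).
- by rewrite /component addNr coef0.
move=> r s; have /(congr1 (coef^~ (r + s + p))) := ED (h r) (h s).
rewrite (br_h hL) (linear_mapZ _ _ EL) (linear_mapZ _ _ (coef_linear hL _)).
rewrite (linear_mapD _ _ (coef_linear hL _)) coef_brl coef_brr.
have -> : r + s + p - s = r + p by rewrite [r + s + p]addrAC addrK.
by have -> : r + s + p - r = s + p by rewrite [r + s]addrC [s + r + p]addrAC addrK.
Qed.

Lemma coef_component E y t : linear E ->
  coef (E y) t = \sum_(q <- supp y) coef y q * component E (t - q) q.
Proof.
move=> EL; rewrite (coef_image hL) //; apply: eq_bigr => q _.
by rewrite /component addrC subrK.
Qed.

Lemma locally_finite_component0 E p r :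
  is_derivation E -> locally_finite E -> p != 0 -> component E p r = 0.
Proof.
move=> ED Efin p0; apply: contraTeq isT => c0.
have w0 s t : ((omega s t)%:~R == 0 :> K) = (omega s t == 0).
  exact: intr_eq0_pchar0.
pose e i : 'cV[int]_(m + m) := delta_mx i 0.
(* By [component_inner], a nonzero component of nonzero degree is already detected on unit
   vectors. *)
pose nz q := (q != 0) && [exists i, component E q (e i) != 0].
have nzP q s : q != 0 -> component E q s != 0 -> nz q.
  move=> q0; have [k kE] := component_inner ED q0; rewrite kE /nz q0 /=.
  rewrite mulf_eq0 negb_or => /andP [k0 _].
  have [i qi] := omega_delta_neq0 q0.
  by apply/existsP; exists i; rewrite kE mulf_neq0 // w0.
(* A finite list of all such degrees: each is [t - e i] for some [t] in the support of
   [E (h (e i))]. *)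
pose D := [seq q <- flatten [seq [seq t - e i | t <- supp (E (h (e i)))]
                            | i <- enum 'I_(m + m)] | nz q].
have mD q : nz q -> q \in D.
  move=> qnz; rewrite mem_filter qnz; apply/flatten_mapP.
  have /andP [_ /existsP [i qi]] := qnz.
  exists i; first by rewrite mem_enum.
  by apply/mapP; exists (e i + q); rewrite ?mem_supp // addrC addKr.
have pD := mD _ (nzP _ _ p0 c0).
have [p' + pmax] := exists_maximizer (fun q => `|dot q q|%N) pD.
rewrite mem_filter => /andP [/andP [{}p0 /existsP [i0 i0P]] _].
move: p' p0 pmax i0P => {c0 pD}p p0 pmax i0P.
have pp0 : 0 < dot p p by rewrite lt_def dot_eq0 p0 dot_ge0.
(* Degree 0 also falls strictly below [p], since [dot p p] is positive. *)
have Edeg q s : component E q s != 0 -> q = p \/ dot p q < dot p p.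
  have [->|q0] := eqVneq q 0; first by right; rewrite -(subrr p) dotDr dotNr subrr.
  have [->|qp] := eqVneq q p; first by left.
  move=> /(nzP _ _ q0)/mD/pmax; have := dot_ge0 q => qq0 le_qp.
  by right; apply: dot_lt_max => //; lia.
have [k0 k0E] := component_inner ED p0.
move: i0P; set s0 := e i0; rewrite k0E mulf_eq0 negb_or => /andP [k00 ws0].
(* Since [omega p p = 0], the factor [omega p (top k)] keeps the nonzero value [omega p s0] at every
   iteration. *)
pose top (k : nat) := s0 + k%:Z *: p.
have topS k : top k.+1 = top k + p.
  by rewrite /top -[k.+1]addn1 PoszD scalerDl scale1r addrA.
have iterE k : let y := iter k E (h s0) in coef y (top k) != 0 /\
    forall t, coef y t != 0 -> t = top k \/ dot p t < dot p (top k).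
  have s00 : s0 != 0 by apply: contraNneq ws0 => ->; rewrite omega0r.
  elim: k => [|k] /=.
    rewrite /top scale0r addr0 coef_h eqxx s00 oner_eq0; split => // t.
    by rewrite coef_h; have [->|_] := eqVneq s0 t; [left | rewrite eqxx].
  move: (iter k E (h s0)) => y [ytop ylt].
  have step t q : coef y q * component E (t - q) q != 0 ->
      (q = top k /\ t = top k.+1) \/ dot p t < dot p (top k.+1).
    rewrite mulf_eq0 negb_or => /andP [/ylt qlt /Edeg tq].
    move: tq qlt; have <- := subrK q t; rewrite addrK [_ - _ + q]addrC topS.
    move: (t - q) => d tq qlt.
    case: qlt => [->|qlt]; case: tq => [->|tq]; first by left.
    - by right; rewrite !dotDr ltrD2l.
    - by right; rewrite (dotDr _ q) (dotDr _ (top k)) ltrD2r.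
    - by right; rewrite (dotDr _ q) (dotDr _ (top k)) ltrD.

  split; last first.
    move=> t; rewrite (coef_component _ _ ED.1) => ct.
    have [q qt] : exists q, coef y q * component E (t - q) q != 0.
      have [/hasP [q _ qt]|/hasPn none] := boolP
        (has (fun q => coef y q * component E (t - q) q != 0) (supp y)).
        by exists q.
      by move: ct; rewrite big_seq big1 ?eqxx // => q /none; rewrite negbK => /eqP.
    by case: (step t q qt) => [[_ ->]|]; [left | right].
  (* Only [q = top k], moved by the degree [p], reaches [top k.+1], so no cancellation can occur
     there. *)
  rewrite (coef_component _ _ ED.1) (bigD1_seq (top k)) ?mem_supp ?supp_uniq //=.
  rewrite big1 => [|q /negPf qtop]; last first.
    apply: contraTeq isT => /step; rewrite ltxx.
    by case=> // [[/eqP]]; rewrite qtop.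
  rewrite addr0 topS addrAC subrr add0r mulf_neq0 // k0E mulf_neq0 //.
  by rewrite /top omegaDr omegaZr omegarr mulr0 addr0.
have [S mS] := Efin (h s0).
have top_inj : injective top.
  move=> k1 k2 /addrI/eqP; rewrite -subr_eq0 -scalerBl scalemx_eq0 (negPf p0).
  by rewrite orbF subr_eq0 => /eqP [].
(* Pigeonhole: one more distinct exponent than [S] can hold. *)
have : {subset [seq top k | k <- iota 0 (size S).+1] <= S}.
  by move=> _ /mapP [k _ ->]; apply: (mS k); case: (iterE k).
move=> sub; have := uniq_leq_size _ sub; rewrite map_inj_uniq ?iota_uniq //.
by move=> /(_ isT); rewrite size_map size_iota ltnn.
Qed.

Lemma locally_finite_diagonal E r :
  is_derivation E -> locally_finite E -> E (h r) = coef (E (h r)) r *: h r.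
Proof.
move=> ED Efin; apply: (@eq_coef _ _ _ _ _ hL) => t.
rewrite (linear_mapZ _ _ (coef_linear hL t)) coef_h.
have [<-|tr] := eqVneq r t.
  have [->|r0] := eqVneq r 0; first by rewrite coef0 scaler0.
  by rewrite /GRing.scale /= mulr1.
rewrite scaler0 -(locally_finite_component0 r ED Efin (p := t - r)).
  by rewrite /component addrC subrK.
by rewrite subr_eq0 eq_sym.
Qed.

End Derivations.

(** * Automorphisms are monomial *)

Section Automorphisms.
Variables (K : fieldType) (m : nat) (L : lmodType K) (br : L -> L -> L).
Variable h : 'cV[int]_(m + m) -> L.
Hypothesis hL : @is_Hprime K m L br h.
Hypothesis hK : [pchar K] =i pred0.
Implicit Types (r s t p q : 'cV[int]_(m + m)) (x y : L).
Local Notation coef := (coef hL).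
Local Notation supp := (supp hL).

Definition degree_derivation i : L -> L := extend hL (fun r => (r i 0)%:~R *: h r).

Lemma degree_derivation_linear i : linear (degree_derivation i).
Proof. by apply: extend_linear; rewrite (h0 hL) scaler0. Qed.

Lemma degree_derivation_h i r : degree_derivation i (h r) = (r i 0)%:~R *: h r.
Proof. by rewrite /degree_derivation extend_h // (h0 hL) scaler0. Qed.

Lemma degree_derivationP i : is_derivation br (degree_derivation i).
Proof.
have dL := degree_derivation_linear i; split => //.
have [brl brr] := (br_linearl hL, br_linearr hL).
apply: (eq_bilinear hL) => [y|x|y|x|r s].
- exact: linear_comp dL (brl y).
- exact: linear_comp dL (brr x).
- exact: linear_add (linear_comp (brl y) dL) (brl _).
- exact: linear_add (brr _) (linear_comp (brr x) dL).
rewrite (br_h hL) (linear_mapZ _ _ dL) !degree_derivation_h.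
rewrite (linear_mapZ _ _ (brl _)) (linear_mapZ _ _ (brr _)) (br_h hL).
by rewrite mxE rmorphD scalerA mulrC -scalerA scalerDl.
Qed.

Lemma coef_degree_derivation i y t :
  coef (degree_derivation i y) t = (t i 0)%:~R * coef y t.
Proof.
move: y; apply: (eq_linear hL (V := K^o)).
- exact: linear_comp (coef_linear hL t) (degree_derivation_linear i).
- exact: (linear_scale (V := K^o) (t i 0)%:~R (coef_linear hL t)).
move=> r; rewrite degree_derivation_h (linear_mapZ _ _ (coef_linear hL t)) coef_h.
by case: (eqVneq r t) => [->|_] //; rewrite scaler0 mulr0.
Qed.

Lemma supp_iter_degree_derivation i k y t :
  coef (iter k (degree_derivation i) y) t != 0 -> t \in supp y.
Proof.
elim: k => [|k IH] /=; first by rewrite mem_supp.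
by rewrite coef_degree_derivation mulf_eq0 negb_or => /andP [_ /IH].
Qed.

Lemma LieAut_inverse f : is_LieAut br f ->
  exists g, [/\ is_LieAut br g, cancel f g & cancel g f].
Proof.
case=> fL [g fK gK] fbr; exists g; split=> //; split; last 1 first.
- by move=> x y; apply: (can_inj fK); rewrite fbr !gK.
- by move=> c x y; apply: (can_inj fK); rewrite fL !gK.
- by exists f.
Qed.

Lemma LieAut_h f r : is_LieAut br f -> r != 0 ->
  exists s b, [/\ s != 0, b != 0 & f (h r) = b *: h s].
Proof.
move=> fA r0; have [g [gA fK gK]] := LieAut_inverse fA.
have [[fL _ fbr] [gL _ gbr]] := (fA, gA).
pose E i := g \o (degree_derivation i \o f).
have EL i : linear (E i).
  exact: linear_comp gL (linear_comp (degree_derivation_linear i) fL).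
have Eder i : is_derivation br (E i).
  split=> [//|x y]; rewrite /E /= fbr (degree_derivationP i).2.
  by rewrite (linear_mapD _ _ gL) !gbr !fK.
(* Iterates telescope to [g], a power of [degree_derivation i], and [f]. The middle factor does not
   enlarge supports, so the supports of [g (h q)] for [q] in [supp (f y)] suffice. *)
have Efin i : locally_finite hL (E i).
  move=> y; exists (flatten [seq supp (g (h q)) | q <- supp (f y)]) => k t.
  have -> : iter k (E i) y = g (iter k (degree_derivation i) (f y)).
    by elim: k => [|k IH] /=; rewrite ?fK // IH /E /= gK.
  rewrite (coef_image hL _ _ gL) => ct; apply/flatten_mapP.
  have [/hasP [q qz qt]|/hasPn none] := boolP (has (fun q =>
      coef (iter k (degree_derivation i) (f y)) q * coef (g (h q)) t != 0)
      (supp (iter k (degree_derivation i) (f y)))); last first.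
    by move: ct; rewrite big_seq big1 ?eqxx // => q /none; rewrite negbK => /eqP.
  move: qt; rewrite mulf_eq0 negb_or => /andP [qt gt].
  by exists q; [apply: supp_iter_degree_derivation qt | rewrite mem_supp].
(* Applying [f] turns the eigenvector equation of [E i] at [h r] into one of [degree_derivation i]
   at [f (h r)]. The eigenvalue does not depend on [t], so the support is a single point. *)
have weight i t : coef (f (h r)) t != 0 ->
    (t i 0)%:~R = coef (E i (h r)) r.
  move=> ft; have /(congr1 f) := locally_finite_diagonal hK r (Eder i) (Efin i).
  rewrite {1}/E /= gK (linear_mapZ _ _ fL) => /(congr1 (coef^~ t)).
  rewrite coef_degree_derivation (linear_mapZ _ _ (coef_linear hL t)).
  exact: mulIf.
have [s fs] : exists s, coef (f (h r)) s != 0.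
  have [/hasP [s _ fs]|/hasPn none] := boolP
    (has (fun s => coef (f (h r)) s != 0) (supp (f (h r)))); first by exists s.
  have /eqP [] := h_neq0 hL r0; apply: (can_inj fK).
  rewrite (linear_map0 fL) [f _](supp_expand hL) big_seq big1 // => s /none.
  by rewrite negbK => /eqP ->; rewrite scale0r.
have s0 : s != 0 by apply: contraNneq fs => ->; rewrite coef0.
exists s, (coef (f (h r)) s); split=> //; apply: (@eq_coef _ _ _ _ _ hL) => t.
rewrite (linear_mapZ _ _ (coef_linear hL t)) coef_h.
have [<-|st] := eqVneq s t; first by rewrite s0 /GRing.scale /= mulr1.
rewrite scaler0; apply: contraNeq st => ft.
apply/eqP/matrixP => i j; rewrite ord1; apply/eqP.
by rewrite -subr_eq0 -(intr_eq0_pchar0 hK) rmorphB /= !weight // subrr.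
Qed.

Lemma LieAut_monomial f : is_LieAut br f -> exists sigma b,
  [/\ sigma 0 = 0, forall r, r != 0 -> sigma r != 0, forall r, b r != 0 &
      forall r, f (h r) = b r *: h (sigma r)].
Proof.
(* The default of [head] gives [sigma 0 = 0]. The value 1 of [b] at 0 keeps [b] nowhere zero and is
   harmless because [h 0 = 0]. *)
move=> fA; pose sigma r := head 0 (supp (f (h r))).
pose b r := if r == 0 then 1 else coef (f (h r)) (sigma r).
have suppE s (c : K) : s != 0 -> c != 0 -> supp (c *: h s) = [:: s].
  move=> s0 c0; apply/perm_small_eq => //; apply: uniq_perm; rewrite ?supp_uniq //.
  move=> t; rewrite mem_supp (linear_mapZ _ _ (coef_linear hL t)) coef_h inE.
  rewrite [s == t]eq_sym; have [->|_] := eqVneq t s; last by rewrite scaler0 eqxx.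
  by rewrite s0 /GRing.scale /= mulr1 c0.
have fE r : r != 0 -> [/\ sigma r != 0, b r != 0 & f (h r) = b r *: h (sigma r)].
  move=> r0; have [s [c [s0 c0 fr]]] := LieAut_h fA r0.
  have sr : sigma r = s by rewrite /sigma fr suppE.
  have br_c : b r = c.
    rewrite /b (negPf r0) sr fr (linear_mapZ _ _ (coef_linear hL s)) coef_h.
    by rewrite eqxx s0 /GRing.scale /= mulr1.
  by rewrite sr br_c.
have f0 : f (h 0) = 0 by case: fA => fL _ _; rewrite (h0 hL) (linear_map0 fL).
have sigma0 : sigma 0 = 0.
  have : supp (0 : L) = [::].
    case sE : (supp 0) => [//|t l]; have := mem_head t l.
    by rewrite -sE mem_supp (linear_map0 (coef_linear hL t)) eqxx.
  by rewrite /sigma f0 => ->.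
exists sigma, b; split=> // r; first by case/fE.
  by have [->|/fE []//] := eqVneq r 0; rewrite /b eqxx oner_eq0.
by have [->|/fE []//] := eqVneq r 0; rewrite f0 sigma0 (h0 hL) scaler0.
Qed.

End Automorphisms.

(** * Homomorphisms out of the lattice *)

Section LatticeHomomorphisms.
Variable n : nat.
Implicit Types (r s : 'cV[int]_n).

Lemma cV_sum_delta r : r = \sum_i r i 0 *: delta_mx i 0.
Proof. by rewrite {1}[r]matrix_sum_delta; apply: eq_bigr => i _; rewrite big_ord1. Qed.

Lemma additive_mulmx (phi : 'cV[int]_n -> 'cV[int]_n) :
  {morph phi : r s / r + s} ->
  phi =1 mulmx (\matrix_(i, j) phi (delta_mx j 0) i 0).
Proof.
move=> phiD; set Q := \matrix_(i, j) _ => r.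
have phi0 : phi 0 = 0 by apply: (addIr (phi 0)); rewrite -phiD !add0r.
have phiN s : phi (- s) = - phi s.
  by apply: (addIr (phi s)); rewrite -phiD !addNr.
have phiZ (z : int) s : phi (z *: s) = z *: phi s.
  have phiMn k : phi (s *+ k) = phi s *+ k.
    by elim: k => [|k IH]; rewrite ?mulr0n // !mulrSr phiD IH.
  rewrite -[z]intz !scaler_int; case: (z) => k; rewrite ?NegzE.
    by rewrite -!pmulrn.
  by rewrite !mulrNz -!pmulrn phiN phiMn.
rewrite {1}[r]cV_sum_delta {2}[r]cV_sum_delta (big_morph _ phiD phi0) mulmx_sumr.
apply: eq_bigr => i _; rewrite phiZ -scalemxAr -colE; congr (_ *: _).
by apply/matrixP => k j; rewrite ord1 !mxE.
Qed.

Variable K : fieldType.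
Implicit Types (a : 'rV[K]_n) (Q : 'M[int]_n).

(** For [a] in the torus, this is the homomorphism from the lattice to the units of [K] that sends
    the unit vectors to the coordinates of [a]. *)
Definition character a r : K := \prod_i a 0 i ^ r i 0.

Lemma morph_character (phi : 'cV[int]_n -> K) :
  (forall r, phi r != 0) -> (forall r s, phi (r + s) = phi r * phi s) ->
  phi =1 character (\row_i phi (delta_mx i 0)).
Proof.
move=> phi_neq0 phiD r.
have phi0 : phi 0 = 1 by apply: (mulIf (phi_neq0 0)); rewrite -phiD add0r mul1r.
have phiN s : phi (- s) = (phi s)^-1.
  by apply: (mulIf (phi_neq0 s)); rewrite -phiD addNr mulVf.
have phiZ (z : int) s : phi (z *: s) = phi s ^ z.
  have phiMn k : phi (s *+ k) = phi s ^+ k.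
    by elim: k => [|k IH]; rewrite ?mulr0n // mulrSr phiD IH exprSr.
  rewrite -[z in LHS]intz scaler_int; case: z => k; rewrite ?NegzE.
    by rewrite -pmulrn phiMn.
  by rewrite mulrNz -pmulrn phiN phiMn -exprnN.
rewrite [r in LHS]cV_sum_delta (big_morph _ phiD phi0).
by apply: eq_bigr => i _; rewrite phiZ mxE.
Qed.

Lemma character_neq0 a r : is_torus a -> character a r != 0.
Proof. by move=> aT; apply/prodf_neq0 => i _; apply/expfz_neq0/aT. Qed.

Lemma characterD a r s : is_torus a ->
  character a (r + s) = character a r * character a s.
Proof.
by move=> aT; rewrite -big_split; apply: eq_bigr => i _; rewrite mxE expfzDr.
Qed.

Lemma character_delta a i : character a (delta_mx i 0) = a 0 i.
Proof.
rewrite /character (bigD1 i) //= big1 => [|j /negPf ji]; rewrite mxE.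
  by rewrite !eqxx mulr1 expr1z.
by rewrite ji expr0z.
Qed.

(** This identity matches the torus part [sd_mulT] of the group law with composition of maps. *)
Lemma character_torus_act Q a r : is_torus a ->
  character (torus_act Q a) r = character a (Q *m r).
Proof.
move=> aT; transitivity (\prod_i \prod_j a 0 j ^ (Q j i * r i 0)).
  apply: eq_bigr => i _; rewrite mxE.
  rewrite (big_morph (fun x : K => x ^ r i 0) (fun x y => expfzMl x y (r i 0)) (exp1rz _ _)).
  by apply: eq_bigr => j _; rewrite exprz_exp.
rewrite exchange_big; apply: eq_bigr => j _; rewrite mxE.
by rewrite (big_morph _ (fun x y => expfzDr x y (aT j)) (expr0z _)).
Qed.

Lemma character_mul a1 a2 r :
  character (\row_i (a1 0 i * a2 0 i)) r = character a1 r * character a2 r.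
Proof.
by rewrite -big_split; apply: eq_bigr => i _; rewrite mxE expfzMl.
Qed.

End LatticeHomomorphisms.

(** * Proportional forms and the multiplier of a similitude *)

Section ProportionalForms.
Variable m : nat.
Implicit Types (r s t : 'cV[int]_(m + m)) (Q : 'M[int]_(m + m)).

(* The vector omega(r, s) t - omega(r, t) s is omega-orthogonal to r. *)
Lemma omega_mulmx_proportional Q : (0 < m)%N ->
  (forall r s, omega r s = 0 -> omega (Q *m r) (Q *m s) = 0) ->
  exists l, forall r s, omega (Q *m r) (Q *m s) = l * omega r s.
Proof.
move=> m_gt0 Q0; pose B r s := omega (Q *m r) (Q *m s).
have BDr r s t : B r (s + t) = B r s + B r t by rewrite /B mulmxDr omegaDr.
have BZr r z s : B r (z *: s) = z * B r s by rewrite /B -scalemxAr omegaZr.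
have cross r s t : omega r s * B r t = omega r t * B r s.
  have : B r (omega r s *: t + (- omega r t) *: s) = 0.
    by apply: Q0; rewrite omegaDr !omegaZr; ring.
  by rewrite BDr !BZr => /eqP; rewrite mulNr subr_eq0 => /eqP.
have BC r s : B r s = - B s r by exact: omega_antisym.
(* A hyperbolic pair: since [omega a b = 1], the ratio of the two forms is the integer [B a b],
   without division. *)
pose a : 'cV[int]_(m + m) := delta_mx (rshift m (Ordinal m_gt0)) 0.
pose b : 'cV[int]_(m + m) := delta_mx (lshift m (Ordinal m_gt0)) 0.
have ab : omega a b = 1 by exact: omega_delta_pair.
have aE s : B a s = B a b * omega a s.
  by have := cross a b s; rewrite ab mul1r => ->; rewrite mulrC.
have nonorth r s : omega a s != 0 -> B r s = B a b * omega r s.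
  move=> as0; apply: (mulfI as0); have := cross s a r.
  rewrite (omega_antisym s a) (BC s r) (omega_antisym s r) (BC s a) aE.
  by rewrite !mulNr !mulrN !opprK => ->; ring.
exists (B a b) => r s; rewrite -/(B r s).
have [as0|] := eqVneq (omega a s) 0; last exact: nonorth.
(* Both [s + b] and [b] are nonorthogonal to [a]. *)
have -> : s = (s + b) + (-1) *: b by rewrite scaleN1r addrK.
rewrite BDr BZr (nonorth r (s + b)) ?(nonorth r b) ?omegaDr ?as0 ?ab //.
by rewrite omegaZr; ring.
Qed.

Lemma mxbilinear_inj (A B : 'M[int]_(m + m)) :
  (forall r s, (r^T *m A *m s) 0 0 = (r^T *m B *m s) 0 0) -> A = B.
Proof.
move=> AB; apply/matrixP => i j; have := AB (delta_mx i 0) (delta_mx j 0).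
by rewrite !trmx_delta -!rowE -!colE !mxE.
Qed.

Lemma omega_mulmxE Q l : (forall r s, omega (Q *m r) (Q *m s) = l * omega r s) <->
  Q^T *m Jmat m *m Q = l *: Jmat m.
Proof.
have omegaQ r s : omega (Q *m r) (Q *m s)
    = - (r^T *m (Q^T *m Jmat m *m Q) *m s) 0 0.
  by rewrite omegaE trmx_Jmat trmx_mul mulmxN !mulNmx mxE !mulmxA.
have omegaJ r s : l * omega r s = - (r^T *m (l *: Jmat m) *m s) 0 0.
  rewrite omegaE trmx_Jmat -scalemxAr -scalemxAl mulmxN mulNmx.
  by rewrite [X in l * X]mxE [X in _ = - X]mxE mulrN.
split=> [QE|QE r s]; last by rewrite omegaQ QE omegaJ.
by apply: mxbilinear_inj => r s; apply: oppr_inj; rewrite -omegaQ -omegaJ.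
Qed.

Lemma GSp_of_multiplier Q l : l * l = 1 ->
  Q^T *m Jmat m *m Q = l *: Jmat m -> is_GSp Q.
Proof.
move=> ll QE; split; last first.
  have /orP : (l == 1) || (l == -1) by rewrite -sqrf_eq1 expr2 ll.
  by rewrite QE; case=> /eqP ->; [left; rewrite scale1r | right; rewrite scaleN1r].
(* As [J] squares to -1 and [l] to 1, the matrix [- l J Q^T J] is a left inverse of [Q]. *)
have [] // := @mulmx1_unit _ _ (- l *: (Jmat m *m Q^T *m Jmat m)) Q.
rewrite -scalemxAl -!mulmxA [Q^T *m _]mulmxA QE -scalemxAr mul_JmatJmat.
by rewrite scalerA mulNr ll scaleN1r opprK.
Qed.

(** The similitude character of [is_GSp]; outside that group the value -1 is a mere default. *)
Definition multiplier Q : int := if Q^T *m Jmat m *m Q == Jmat m then 1 else -1.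

Lemma multiplierP Q : is_GSp Q -> Q^T *m Jmat m *m Q = multiplier Q *: Jmat m.
Proof.
rewrite /multiplier; case=> _; case: eqP => [->|QJ [//|->]]; first by rewrite scale1r.
by rewrite scaleN1r.
Qed.

Lemma multiplier_sqr Q : multiplier Q * multiplier Q = 1.
Proof. by rewrite /multiplier; case: ifP. Qed.

(** For positive [m] the matrix [J] is nonzero, because it squares to -1; hence [Q] determines its
    multiplier. *)
Lemma Jmat_scaler_inj : (0 < m)%N -> injective (fun l => l *: Jmat m).
Proof.
move=> m_gt0 l1 l2 /eqP; rewrite -subr_eq0 -scalerBl scalemx_eq0 subr_eq0.
case/orP => /eqP // J0; have := mul_JmatJmat m; rewrite J0 mul0mx => /eqP.
pose i := lshift m (Ordinal m_gt0).
rewrite eq_sym oppr_eq0 => /eqP/matrixP /(_ i i).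
by rewrite !mxE eqxx.
Qed.

Lemma multiplier_eq Q l : (0 < m)%N -> l * l = 1 ->
  Q^T *m Jmat m *m Q = l *: Jmat m -> multiplier Q = l.
Proof.
move=> m_gt0 ll QE; apply: (Jmat_scaler_inj m_gt0); rewrite -QE.
exact/esym/multiplierP/(GSp_of_multiplier ll QE).
Qed.

Lemma GSp_mul Q1 Q2 : is_GSp Q1 -> is_GSp Q2 ->
  (Q1 *m Q2)^T *m Jmat m *m (Q1 *m Q2) = (multiplier Q1 * multiplier Q2) *: Jmat m.
Proof.
move=> G1 G2; rewrite trmx_mul -!mulmxA [Jmat m *m _]mulmxA [Q1^T *m _]mulmxA.
rewrite [Q1^T *m _]mulmxA multiplierP // -scalemxAl -scalemxAr mulmxA.
by rewrite multiplierP // scalerA.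
Qed.

Lemma GSp_inv Q : is_GSp Q ->
  (invmx Q)^T *m Jmat m *m invmx Q = multiplier Q *: Jmat m.
Proof.
move=> G; have [uQ _] := G; have uQT : Q^T \in unitmx by rewrite unitmx_tr.
rewrite trmx_inv; apply: (can_inj (mulKmx uQT)); apply: (can_inj (mulmxK uQ)).
rewrite -!mulmxA mulVmx // mulmx1 mulKVmx // -scalemxAl -scalemxAr mulmxA.
by rewrite multiplierP // scalerA multiplier_sqr scale1r.
Qed.

End ProportionalForms.

(** * Classification of the automorphisms *)

Section Classification.
Variables (K : fieldType) (m : nat) (L : lmodType K) (br : L -> L -> L).
Variable h : 'cV[int]_(m + m) -> L.
Hypothesis hL : @is_Hprime K m L br h.
Hypothesis hK : [pchar K] =i pred0.
Hypothesis m_gt0 : (0 < m)%N.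
Implicit Types (r s t : 'cV[int]_(m + m)) (Q : 'M[int]_(m + m)) (a : 'rV[K]_(m + m)).

(** If [Q] multiplies [omega] by a sign [e], a constant factor [c] in front respects brackets when
    [c = c^2 e]; for nonzero [c] this means [c = e], whence the multiplier. *)
Definition toric Q a : L -> L :=
  extend hL (fun r => ((multiplier Q)%:~R * character a r) *: h (Q *m r)).

Lemma toric_linear Q a : linear (toric Q a).
Proof. by apply: extend_linear; rewrite mulmx0 (h0 hL) scaler0. Qed.

Lemma toric_h Q a r :
  toric Q a (h r) = ((multiplier Q)%:~R * character a r) *: h (Q *m r).
Proof. by rewrite /toric extend_h // mulmx0 (h0 hL) scaler0. Qed.

Lemma toric_mul Q1 a1 Q2 a2 : is_GSp Q1 -> is_torus a1 -> is_GSp Q2 ->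
  toric (sd_mulM Q1 Q2) (sd_mulT Q2 a1 a2) =1 toric Q1 a1 \o toric Q2 a2.
Proof.
move=> G1 aT G2; apply: (eq_linear hL) => [||r].
- exact: toric_linear.
- exact: linear_comp (toric_linear _ _) (toric_linear _ _).
rewrite /= !toric_h (linear_mapZ _ _ (toric_linear _ _)) toric_h scalerA mulmxA.
rewrite character_mul character_torus_act //; congr (_ *: _).
rewrite /sd_mulM (multiplier_eq m_gt0 _ (GSp_mul G1 G2)); first by rewrite intrM; ring.
by rewrite mulrACA !multiplier_sqr.
Qed.

Lemma toric_inverse Q a : is_GSp Q -> is_torus a -> exists Q' a',
  [/\ is_GSp Q', is_torus a' & cancel (toric Q' a') (toric Q a)].
Proof.
move=> G aT; have [uQ _] := G; pose Q' := invmx Q.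
have G' : is_GSp Q' := GSp_of_multiplier (multiplier_sqr Q) (GSp_inv G).
(* Solves [sd_mulT Q' a a' = 1], the torus part of the equation for an inverse. *)
pose a' := \row_i (torus_act Q' a 0 i)^-1.
have a'T : is_torus a'.
  by move=> i; rewrite !mxE invr_eq0; apply/prodf_neq0 => j _; apply/expfz_neq0/aT.
exists Q', a'; split=> // x; rewrite -[LHS](toric_mul a' G aT G').
move: x; apply: (eq_linear hL (g := id)) => [||r] //; first exact: toric_linear.
have -> : sd_mulT Q' a a' = \row_i 1.
  apply/rowP => i; rewrite [LHS]mxE [RHS]mxE [a' _ _]mxE mulfV //.
  by have := a'T i; rewrite mxE invr_eq0.
have -> : sd_mulM Q Q' = 1%:M by rewrite /sd_mulM mulmxV.
have mult1 : multiplier (1%:M : 'M[int]_(m + m)) = 1.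
  by rewrite /multiplier trmx1 mul1mx mulmx1 eqxx.
rewrite toric_h mult1 mul1mx mul1r.
by rewrite /character big1 ?mulr1 ?scale1r // => i _; rewrite mxE exp1rz.
Qed.

Lemma toric_LieAut Q a : is_GSp Q -> is_torus a -> is_LieAut br (toric Q a).
Proof.
move=> G aT; have tL := toric_linear Q a; split=> //.
  (* A right inverse that itself has a right inverse is two-sided. *)
  have [Q' [a' [G' a'T QK]]] := toric_inverse G aT.
  have [Q'' [a'' [_ _ Q'K]]] := toric_inverse G' a'T.
  exists (toric Q' a') => // x.
  by rewrite -[x in toric Q a x]Q'K QK Q'K.
have [brl brr] := (br_linearl hL, br_linearr hL).
apply: (eq_bilinear hL) => [y|x|y|x|r s].
- exact: linear_comp tL (brl y).
- exact: linear_comp tL (brr x).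
- exact: (linear_comp (brl _) tL).
- exact: (linear_comp (brr _) tL).
rewrite !toric_h (br_h hL) (linear_mapZ _ _ tL) toric_h.
rewrite (linear_mapZ _ _ (brl _)) (linear_mapZ _ _ (brr _)) (br_h hL).
rewrite ((omega_mulmxE _ _).2 (multiplierP G)) mulmxDr characterD // !scalerA.
have ee : (multiplier Q)%:~R * (multiplier Q)%:~R = 1 :> K.
  by rewrite -intrM multiplier_sqr.
congr (_ *: _); rewrite intrM; move: ee.
by move: _%:~R (omega r s)%:~R => e w ee; rewrite -[LHS]mul1r -ee; ring.
Qed.

(** On unit vectors, the exponents of the images are the columns of [Q], and then the coefficients
    give the coordinates of [a]. *)
Lemma toric_inj Q a Q' a' : is_GSp Q -> is_torus a -> is_GSp Q' ->
  toric Q a =1 toric Q' a' -> Q = Q' /\ a = a'.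
Proof.
move=> [uQ _] aT _ QQ'.
have mult_neq0 (R : 'M[int]_(m + m)) : (multiplier R)%:~R != 0 :> K.
  by rewrite /multiplier; case: ifP; rewrite ?rmorphN ?oppr_eq0 oner_eq0.
have E r := etrans (esym (toric_h Q a r)) (etrans (QQ' (h r)) (toric_h Q' a' r)).
have Q_neq0 r : r != 0 -> Q *m r != 0.
  by apply: contra_neq => Qr0; rewrite -(mulKmx uQ r) Qr0 mulmx0.
have delta_neq0 i : delta_mx i 0 != 0 :> 'cV[int]_(m + m).
  apply/eqP => /matrixP/(_ i 0); rewrite !mxE !eqxx; exact/eqP/oner_neq0.
have coef_neq0 r : (multiplier Q)%:~R * character a r != 0.
  by rewrite mulf_neq0 ?character_neq0.
have QE : Q = Q'.
  apply/matrixP => i j; have := h_inj hL (Q_neq0 _ (delta_neq0 j)) (coef_neq0 _) (E _).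
  by rewrite -!colE => /matrixP/(_ i 0); rewrite !mxE.
split=> //; apply/rowP => i; have := E (delta_mx i 0); rewrite -QE => /eqP.
rewrite -subr_eq0 -scalerBl scaler_eq0 (negPf (h_neq0 hL (Q_neq0 _ (delta_neq0 i)))).
by rewrite orbF subr_eq0 !character_delta => /eqP/(mulfI (mult_neq0 _)).
Qed.

Lemma LieAut_toric f : is_LieAut br f ->
  exists Q a, [/\ is_GSp Q, is_torus a & f =1 toric Q a].
Proof.
move=> fA; have [sigma [b [sigma0 sigma_neq0 b_neq0 fE]]] := LieAut_monomial hL hK fA.
have [g [gA fK gK]] := LieAut_inverse fA; have [fL _ fbr] := fA.
have w0 r s : ((omega r s)%:~R == 0 :> K) = (omega r s == 0).
  exact: intr_eq0_pchar0.
have nonorth r s : omega r s != 0 -> [/\ r != 0, s != 0 & r + s != 0].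
  move=> rs; split; apply: contraNneq rs => rs0.
  - by rewrite rs0 omega0l.
  - by rewrite rs0 omega0r.
  - by rewrite -[r](addrK s) rs0 add0r omegaNl omegarr.
have brE r s : ((omega r s)%:~R * b (r + s)) *: h (sigma (r + s)) =
    (b r * b s * (omega (sigma r) (sigma s))%:~R) *: h (sigma r + sigma s).
  have := fbr (h r) (h s); rewrite (br_h hL) (linear_mapZ _ _ fL) !fE.
  rewrite (linear_mapZ _ _ (br_linearl hL _)) (linear_mapZ _ _ (br_linearr hL _)).
  by rewrite (br_h hL) !scalerA => ->.
have sigmaD : {morph sigma : r s / r + s}.
  apply: (@morph_of_nonorthogonal m _ +%R 0) => //.
  - exact: addrA.
  - exact: addrC.
  - exact: add0r.
  - by move=> r s t /addIr.
  (* The left side of [brE] is nonzero here, so the exponents on both sides agree. *)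
  move=> r s rs; have [r0 s0 rs0] := nonorth r s rs.
  by apply: (h_inj hL _ _ (brE r s)); rewrite ?sigma_neq0 // mulf_neq0 ?w0.
have [Q sigmaE] : exists Q, forall r, sigma r = Q *m r.
  by eexists; apply: additive_mulmx sigmaD.
(* The right side of [brE] vanishes. If this happens through [h (sigma r + sigma s) = 0], then
   [sigma r = - sigma s] and the form is zero anyway. *)
have omega_eq0 r s : omega r s = 0 -> omega (Q *m r) (Q *m s) = 0.
  move=> rs0; have := brE r s; rewrite rs0 mul0r scale0r => /esym/eqP.
  rewrite scaler_eq0 !mulf_eq0 !(negPf (b_neq0 _)) !orFb w0 -!sigmaE.
  case/orP => [/eqP //|]; apply: contraTeq => rs; apply: (h_neq0 hL).
  apply: contraNneq rs => rs; rewrite -[sigma r](addrK (sigma s)) rs add0r.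
  by rewrite omegaNl omegarr.
have [l lE] := omega_mulmx_proportional m_gt0 omega_eq0.
(* The inverse automorphism is monomial too. *)
have sigma_surj t : t != 0 -> exists s, Q *m s = t.
  move=> t0; have [s [c [s0 c0 gt]]] := LieAut_h hL hK gA t0.
  exists s; have := gK (h t); rewrite gt (linear_mapZ _ _ fL) fE scalerA -sigmaE.
  rewrite -[h t]scale1r; by apply: (h_inj hL); rewrite ?sigma_neq0 ?mulf_neq0.
(* The hyperbolic pair has preimages under [Q], so [l] divides 1. *)
have ll : l * l = 1.
  have e1 := omega_delta_pair (Ordinal m_gt0).
  have [|s Es] := sigma_surj (delta_mx (lshift m (Ordinal m_gt0)) 0).
    by apply: contra_eq_neq e1 => ->; rewrite omega0r eq_sym oner_eq0.
  have [|r Er] := sigma_surj (delta_mx (rshift m (Ordinal m_gt0)) 0).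
    by apply: contra_eq_neq e1 => ->; rewrite omega0l eq_sym oner_eq0.
  move: e1; rewrite -Es -Er lE => e1.
  have : l \is a GRing.unit by apply/unitrPr; exists (omega r s).
  by case/orP => /eqP ->.
have QE := (omega_mulmxE Q l).1 lE.
have multQ : multiplier Q = l := multiplier_eq m_gt0 ll QE.
have llK : l%:~R * l%:~R = 1 :> K by rewrite -intrM ll.
have l0 : l%:~R != 0 :> K by apply: contra_eq_neq llK => ->; rewrite mul0r eq_sym oner_eq0.
(* On nonorthogonal pairs [brE] reads [b (r + s) = l b r b s], so [l b] is multiplicative there. As
   [h 0 = 0] leaves [b 0] undetermined, the value 1 at 0 is imposed. *)
pose chi r := if r == 0 then 1 else l%:~R * b r.
have chi_neq0 r : chi r != 0.
  by rewrite /chi; case: ifP => _; rewrite ?oner_eq0 ?mulf_neq0.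
have chiD r s : chi (r + s) = chi r * chi s.
  apply: (@morph_of_nonorthogonal m _ *%R 1) => //.
  - exact: mulrA.
  - exact: mulrC.
  - exact: mul1r.
  - by move=> x y t /mulIf ->.
  - by rewrite /chi eqxx.
  move=> {}r {}s rs; have [r0 s0 rs0] := nonorth r s rs.
  rewrite /chi !ifN //; apply: (mulfI (_ : (omega r s)%:~R != 0)); first by rewrite w0.
  have := brE r s; rewrite -sigmaD !sigmaE lE => /eqP.
  rewrite -subr_eq0 -scalerBl scaler_eq0 -sigmaE (negPf (h_neq0 hL (sigma_neq0 _ rs0))).
  rewrite orbF subr_eq0 => /eqP E; rewrite mulrCA E intrM; ring.
pose a : 'rV[K]_(m + m) := \row_i chi (delta_mx i 0).
exists Q, a; split.
- exact: GSp_of_multiplier ll QE.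
- by move=> i; rewrite mxE.
apply: (eq_linear hL) => [||r] //; first exact: toric_linear.
rewrite toric_h multQ -(morph_character chi_neq0 chiD) fE sigmaE /chi.
by case: eqVneq => [->|r0]; rewrite ?mulmx0 ?(h0 hL) ?scaler0 // mulrA llK mul1r.
Qed.

End Classification.

(** * The isomorphism with the semidirect product *)

Theorem theorem3p4 (K : closedFieldType) (hK : [pchar K] =i pred0)
  (m : nat) (hm : (0 < m)%N)
  (L : lmodType K) (br : L -> L -> L) (h : 'cV[int]_(m + m) -> L)
  (hL : @is_Hprime K m L br h) :
  exists Phi : 'M[int]_(m + m) -> 'rV[K]_(m + m) -> L -> L,
    [/\ (forall Q a, is_GSp Q -> is_torus a -> is_LieAut br (Phi Q a)),
        (forall f, is_LieAut br f ->
           exists Q a, [/\ is_GSp Q, is_torus a & forall x, f x = Phi Q a x]),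
        (forall Q a Q' a', is_GSp Q -> is_torus a -> is_GSp Q' -> is_torus a' ->
           (forall x, Phi Q a x = Phi Q' a' x) -> Q = Q' /\ a = a') &
        (forall Q1 a1 Q2 a2, is_GSp Q1 -> is_torus a1 -> is_GSp Q2 -> is_torus a2 ->
           forall x, Phi (sd_mulM Q1 Q2) (sd_mulT Q2 a1 a2) x
                     = Phi Q1 a1 (Phi Q2 a2 x))].
Proof.
exists (toric hL); split=> [Q a|f|Q a Q' a' G aT G' _|Q1 a1 Q2 a2 G1 a1T G2 _ x].
- exact: toric_LieAut.
- exact: LieAut_toric.
- exact: toric_inj.
- exact: toric_mul.
Qed.
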